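(* Let $I\ge 2$, $\mathcal I=\{1,\dots,I\}$, $N\ge 1$, let $\bar a_k,\bar b_{ik}\in\mathbb R$ and $q_{ik},q_{iN},r_{ik},\bar q_{ik},\bar q_{iN},\bar r_{ik}>0$ for $i\in\mathcal I$, $k\in\{0,\dots,N-1\}$. Let $\{\epsilon_k\}_k$ be a zero-mean real random process with $\epsilon_0=0$, and let $x_0$ be a given real random variable independent of $\epsilon$. Consider the scalar system with multiplicative noise $$x_{k+1}=\bar a_k x_k+\sum_{i\in\mathcal I}\bar b_{ik}u_{ik}+(x_k-\bar x_k)\epsilon_{k+1},\qquad k\in\{0,\dots,N-1\},$$ in which each agent $i\in\mathcal I$ chooses $(u_{ik})_{k=0}^{N-1}$ in order to minimize the expected value of $$L_i(x_0,u)=q_{iN}\,\mathrm{var}(x_N)+\bar q_{iN}\bar x_N^4+\sum_{k=0}^{N-1}\left(q_{ik}\,\mathrm{var}(x_k)+\bar q_{ik}\bar x_k^4+r_{ik}\,\mathrm{var}(u_{ik})+\bar r_{ik}\bar u_{ik}^4\right),$$ where $\bar x_k=\mathbb E[x_k]$ and $\bar u_{ik}=\mathbb E[u_{ik}]$. Define $\alpha_{ik},\bar\alpha_{ik}$ by backward recursion: $\alpha_{iN}=q_{iN}$, $\bar\alpha_{iN}=\bar q_{iN}$ and, for $k=N-1,\dots,0$, $$\bar\alpha_{ik}=\bar q_{ik}+\bar r_{ik}\left((\bar E_k^{-1}\bar c_k)_i\,\bar a_k\right)^4+\bar\alpha_{i,k+1}\left(\bar a_k-\sum_{j\in\mathcal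 I}(\bar E_k^{-1}\bar c_k)_j\,\bar a_k\bar b_{jk}\right)^4,$$ $$\alpha_{ik}=q_{ik}+r_{ik}\left((E_k^{-1}c_k)_i\,\bar a_k\right)^2+\alpha_{i,k+1}\left(\bar a_k-\sum_{j\in\mathcal I}(E_k^{-1}c_k)_j\,\bar a_k\bar b_{jk}\right)^2+\alpha_{i,k+1}\mathbb E\left(\epsilon_{k+1}^2\right),$$ where $$c_{ik}=\frac{\alpha_{i,k+1}\bar b_{ik}}{r_{ik}+\alpha_{i,k+1}\bar b_{ik}^2},\qquad \bar c_{ik}=\frac{\left(\frac{\bar\alpha_{i,k+1}\bar b_{ik}}{\bar r_{ik}}\right)^{1/3}}{1+\left(\frac{\bar\alpha_{i,k+1}\bar b_{ik}}{\bar r_{ik}}\right)^{1/3}\bar b_{ik}},$$ $c_k=(c_{ik})_{i\in\mathcal I}$, $\bar c_k=(\bar c_{ik})_{i\in\mathcal I}$, and $E_k,\bar E_k$ are the $I\times I$ matrices with $e_{ii,k}=\bar e_{ii,k}=1$ and, for $j\neq i$, $e_{ij,k}=c_{ik}\bar b_{jk}$, $\bar e_{ij,k}=\bar c_{ik}\bar b_{jk}$. Then the (state-and-mean-field-type feedback Nash) equilibrium strategy of the game is $$u_{ik}^*=-(E_k^{-1}c_k)_i\,\bar a_k(x_k-\bar x_k)-(\bar E_k^{-1}\bar c_k)_i\,\bar a_k\bar x_k,\qquad i\in\mathcal I,\ k\in\{0,\dots,N-1\}.$$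
   Context: Cube roots are real (odd) roots; $\mathrm{var}$ denotes variance. The control set of each agent at each step is $\mathbb R$; a strategy of agent $i$ is a sequence $(u_{ik})_{k=0}^{N-1}$ of Lebesgue measurable state-and-mean-field-type feedback maps, $u_{ik}=u_{ik}(x_k,\bar x_k)\in\mathbb R$. A profile $(u_i^* )_{i\in\mathcal I}$ of such strategies is a state-and-mean-field-type feedback Nash equilibrium if, for every $i\in\mathcal I$, when all agents $j\neq i$ use the feedback strategies $u_j^*$, the strategy $u_i^*$ minimizes $\mathbb E[L_i(x_0,u)]$ over all strategies of agent $i$.
   Formalization: The noise variables ε_0,…,ε_N are assumed mutually independent and square-integrable, x_0 is assumed integrable, and the feedback maps are Borel rather than Lebesgue measurable; without independence in time (e.g. ε_2=ε_1=±1) the claim is false. *)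

(* Defs.v *)
(* MathComp / MathComp-Analysis *)
From HB Require Import structures.
From mathcomp Require Import all_boot all_order all_algebra.
From mathcomp Require Import all_classical all_reals all_analysis.
Set Implicit Arguments.
Unset Strict Implicit.
Unset Printing Implicit Defensive.
Import Order.TTheory GRing.Theory Num.Theory numFieldNormedType.Exports.
Local Open Scope classical_set_scope.
Local Open Scope ring_scope.

(* The odd real cube root. *)
Definition cbrt (R : realType) (x : R) : R := Num.sg x * `|x| `^ 3^-1.

Section Noise.
Context (d : measure_display) (T : measurableType d) (R : realType).
Context (P : probability T R).

Definition sigma_rv (X : T -> R) : set (set T) :=
  preimage_set_system setT X measurable.

Definition sigma_process (N : nat) (eps : nat -> T -> R) : set (set T) :=
  <<s [set A | exists2 k, (k <= N)%N & sigma_rv (eps k) A] >>.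

Definition indep_systems (G H : set (set T)) : Prop :=
  forall A B, G A -> H B -> P (A `&` B) = (P A * P B)%E.

(* Mutual independence of eps_0, ..., eps_N.  The product rule for the full
   family contains the one for subfamilies, since B k = setT is allowed. *)
Definition mutually_indep (N : nat) (eps : nat -> T -> R) : Prop :=
  forall B : nat -> set R, (forall k, measurable (B k)) ->
    P (\bigcap_(k < N.+1) eps k @^-1` B k)
    = (\prod_(k < N.+1) P (eps k @^-1` B k))%E.

Definition mean (X : T -> R) : R := fine 'E_P[X].

End Noise.

Section Game.
Context (d : measure_display) (T : measurableType d) (R : realType).
Context (P : probability T R) (n N : nat).
Context (a : nat -> R) (b q qbar r rbar : 'I_n -> nat -> R).
Context (eps : nat -> T -> R) (x0 : T -> R).

(* A feedback map takes the pair (state, mean of the state).  Only the entries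
   k < N of a strategy matter. *)
Definition strategy := nat -> R * R -> R.

(* Borel measurability on R * R.  Lebesgue measurability alone would not make
   the map x |-> u_k (x, m) measurable for the law of the state, because the
   line R * {m} is Lebesgue-null. *)
Definition is_strategy (v : strategy) : Prop :=
  forall k, (k < N)%N -> measurable_fun setT (v k).

Fixpoint state (u : 'I_n -> strategy) (k : nat) : T -> R :=
  if k is k'.+1 then
    let x := state u k' in
    let m := mean P x in
    fun w => a k' * x w + \sum_(i < n) b i k' * u i k' (x w, m)
             + (x w - m) * eps k w
  else x0.

Definition control (u : 'I_n -> strategy) (i : 'I_n) (k : nat) : T -> R :=
  fun w => u i k (state u k w, mean P (state u k)).

(* The means (hence the variances, possibly +oo) occurring in the cost of agent
   i are defined. *)
Definition cost_defined (u : 'I_n -> strategy) (i : 'I_n) : Prop :=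
  (forall k, (k <= N)%N -> P.-integrable setT (EFin \o state u k)) /\
  (forall k, (k < N)%N -> P.-integrable setT (EFin \o control u i k)).

(* L_i only involves means and variances, so it is deterministic and equal to
   its own expectation; its value is +oo when one of the variances is. *)
Definition cost (u : 'I_n -> strategy) (i : 'I_n) : \bar R :=
  ((q i N)%:E * 'V_P[state u N] + (qbar i N * mean P (state u N) ^+ 4)%:E
   + \sum_(0 <= k < N)
       ((q i k)%:E * 'V_P[state u k] + (qbar i k * mean P (state u k) ^+ 4)%:E
        + (r i k)%:E * 'V_P[control u i k]
        + (rbar i k * mean P (control u i k) ^+ 4)%:E))%E.

Definition deviation (u : 'I_n -> strategy) (i : 'I_n) (v : strategy) :
    'I_n -> strategy :=
  fun j => if j == i then v else u j.

(* The other agents keep their feedback maps, which are then evaluated along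
   the trajectory, and its mean, produced by the deviation.  A deviation for
   which the cost of agent i is undefined is not compared. *)
Definition feedback_Nash (u : 'I_n -> strategy) : Prop :=
  forall i : 'I_n,
    [/\ is_strategy (u i), cost_defined u i &
        forall v : strategy, is_strategy v -> cost_defined (deviation u i v) i ->
          (cost u i <= cost (deviation u i v) i)%E].

End Game.

Section Gains.
Context (R : realType) (n : nat).

Definition c_vec (b r alpha : 'I_n -> nat -> R) (k : nat) : 'cV[R]_n :=
  \col_i (alpha i k.+1 * b i k / (r i k + alpha i k.+1 * b i k ^+ 2)).

Definition cbar_vec (b rbar alphabar : 'I_n -> nat -> R) (k : nat) :
    'cV[R]_n :=
  \col_i let s := cbrt (alphabar i k.+1 * b i k / rbar i k) in
         s / (1 + s * b i k).

(* E_k for c = c_k, and its barred counterpart for c = cbar_k. *)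
Definition E_mx (b : 'I_n -> nat -> R) (c : 'cV[R]_n) (k : nat) : 'M[R]_n :=
  \matrix_(i, j) if i == j then 1 else c i 0 * b j k.

Definition gain (b r alpha : 'I_n -> nat -> R) (k : nat) (i : 'I_n) : R :=
  let c := c_vec b r alpha k in (invmx (E_mx b c k) *m c) i 0.

Definition gainbar (b rbar alphabar : 'I_n -> nat -> R) (k : nat) (i : 'I_n) :
    R :=
  let c := cbar_vec b rbar alphabar k in (invmx (E_mx b c k) *m c) i 0.

End Gains.

(* Main.v *)
Require Import Defs.
From HB Require Import structures.
From mathcomp Require Import all_boot all_order all_algebra.
From mathcomp Require Import all_classical all_reals all_analysis.
From mathcomp Require Import measurable_realfun ring lra.
Set Implicit Arguments.
Unset Strict Implicit.
Unset Printing Implicit Defensive.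
Import Order.TTheory GRing.Theory Num.Theory numFieldNormedType.Exports.
Local Open Scope classical_set_scope.
Local Open Scope ring_scope.

(** Along the equilibrium, and along any deviation of one agent i from it, the
    mean m_k and the centered part x_k - m_k of the state evolve separately: the
    other agents feed back a multiple of each, so that for suitable constants A
    and Abar
      x_(k+1) = A (x_k - m_k) + Abar m_k + b u_k + (x_k - m_k) eps_(k+1),
    where u_k is the control of agent i. The noise eps_(k+1) is centered and
    independent of all that happened up to time k, hence
      m_(k+1)  = Abar m_k + b E[u_k],
      V[x_(k+1)] = A^2 V[x_k] + 2 A b Cov(x_k, u_k) + b^2 V[u_k]
                   + E[eps_(k+1)^2] V[x_k].
    So agent i faces a deterministic problem, and the function
    alpha_k V[x_k] + alphabar_k m_k^4 is its Bellman function: one step of the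
    dynamics costs at least the decrease of this function
    ([value_step]), with equality for the candidate strategy
    ([equilibrium_value_step]). Summing over k bounds the cost of any
    deviation from below by the value at time 0, which is the equilibrium cost.

    The one-step bound splits into a variance part and a mean part. In the
    first, the excess cost is a nonnegative multiple of the second moment of
    u_k - E[u_k] + G (x_k - m_k), once the linear terms cancel
    ([quadratic_step]); in the second, convexity of the fourth power puts the
    cost above its tangent at the candidate, and the slopes cancel
    ([quartic_step]). Both cancellations are the first-order conditions
      r_i g_i = alpha_i b_i (1 - sum_j g_j b_j),
      rbar_i gbar_i^3 = alphabar_i b_i (1 - sum_j gbar_j b_j)^3,
    and these are what the linear systems E g = c and Ebar gbar = cbar encode
    ([gain_foc], [gainbar_foc]); the matrices are invertible because the
    products c_i b_i lie in [0, 1).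

    A deviation of infinite cost needs no comparison, and one of finite cost
    has square-integrable states and controls, which is what the moment
    identities require. In particular x_0 is then square-integrable, so that
    the equilibrium has finite cost. *)

(** * Expectation of a product of independent variables *)

Section Independence.
Context (d : measure_display) (T : measurableType d) (R : realType).
Context (P : probability T R).

(* Independence says that the law of (X, Y) is the product of the laws; the
   expectation of the product is then computed by Fubini. *)
Let pair_law (X Y : {RV P >-> R}) :
    indep_systems P (sigma_rv X) (sigma_rv Y) ->
  forall A : set (R * R), measurable A ->
    (distribution P X \x distribution P Y)%E A
      = P ((fun w => (X w, Y w)) @^-1` A).
Proof.
move=> XY A mA.
have mXY : measurable_fun setT (fun w => (X w, Y w)).
  exact: measurable_fun_pair.
pose Z : {RV P >-> (R * R)%type} :=
  HB.pack (fun w => (X w, Y w)) (isMeasurableFun.Build _ _ _ _ _ mXY).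
apply: (@product_measure_unique _ _ _ _ _ (distribution P X) (distribution P Y)
  (distribution P Z)) => //= B C mB mC.
rewrite /distribution /pushforward /=.
by apply: XY; [exists B|exists C] => //; rewrite setTI.
Qed.

Lemma indep_Lfun1M (X Y : {RV P >-> R}) :
    indep_systems P (sigma_rv X) (sigma_rv Y) ->
    (X : T -> R) \in Lfun P 1%E -> (Y : T -> R) \in Lfun P 1%E ->
  (X \* Y \in Lfun P 1%E) /\ ('E_P[X \* Y] = 'E_P[X] * 'E_P[Y])%E.
Proof.
move=> XY X1 Y1; have law := pair_law XY.
have mXY : measurable_fun setT (fun w => (X w, Y w)).
  exact: measurable_fun_pair.
pose Z : {RV P >-> (R * R)%type} :=
  HB.pack (fun w => (X w, Y w)) (isMeasurableFun.Build _ _ _ _ _ mXY).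
pose m1 := distribution P X; pose m2 := distribution P Y.
have mf : measurable_fun [set: R * R] (EFin \o (fun z : R * R => z.1 * z.2)).
  by apply/measurable_EFinP; exact: measurable_funM.
have m1id : m1.-integrable setT EFin.
  apply: integrable_pushforward => //; exact/Lfun1_integrable.
have m2id : m2.-integrable setT EFin.
  apply: integrable_pushforward => //; exact/Lfun1_integrable.
have mabs : measurable_fun [set: R] (EFin \o (fun x : R => `|x|)).
  by apply/measurable_EFinP; exact: normr_measurable.
have inner x : (\int[m2]_y `|(x * y)%:E| = `|x|%:E * \int[m2]_y `|y|%:E)%E.
  rewrite -ge0_integralZl//.
  by apply: eq_integral => y _; rewrite /= normrM.
have intf : (m1 \x m2)%E.-integrable [set: R * R]
    (EFin \o (fun z : R * R => z.1 * z.2)).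
  apply/(integrable12ltyP m1 m2 mf) => /=.
  under eq_integral => x _ do rewrite inner.
  rewrite /= ge0_integralZr//; last exact: integral_ge0.
  apply: lte_mul_pinfty; first exact: integral_ge0.
    rewrite ge0_fin_numE; last exact: integral_ge0.
    by case/integrableP: m1id.
  by case/integrableP: m2id.
have eqm A : measurable A -> A `<=` setT -> distribution P Z A = (m1 \x m2)%E A.
  by move=> mA _; rewrite law.
have intXY : (X \* Y) \in Lfun P 1%E.
  apply/Lfun1_integrable; apply/integrableP; split.
    by apply/measurable_EFinP; exact: measurable_funM.
  case/integrableP : intf => _; rewrite -(eq_measure_integral _ eqm).
  rewrite ge0_integral_distribution//.
  exact: measurableT_comp.
split => //; rewrite unlock.
transitivity
  (\int[distribution P Z]_z (EFin \o (fun z : R * R => z.1 * z.2)%R) z)%E.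
  rewrite integral_distribution//.
  by move/Lfun1_integrable : intXY.
rewrite (eq_measure_integral _ eqm) -integral12_prod_meas1//.
rewrite /fubini_F/=.
under eq_integral => x _.
  under eq_integral => y _ do rewrite EFinM.
  rewrite (@integralZl _ _ _ m2 setT)//.
  over.
have E2 : (\int[m2]_y y%:E = \int[P]_w (Y w)%:E)%E.
  by rewrite integral_distribution//; apply/Lfun1_integrable.
have E1 : (\int[m1]_y y%:E = \int[P]_w (X w)%:E)%E.
  by rewrite integral_distribution//; apply/Lfun1_integrable.
have /fineK EY : (\int[P]_w (Y w)%:E)%E \is a fin_num.
  by apply: integrable_fin_num => //; apply/Lfun1_integrable.
by rewrite /= E2 -E1 -EY integralZr.
Qed.

(** The product rule with a fixed event E is stable under complements and
    disjoint unions, so the pi-lambda theorem extends it from G to the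
    sigma-algebra that G generates. *)
Lemma indep_event_sigma (G : set (set T)) (E : set T) :
    setI_closed G -> G `<=` measurable -> measurable E ->
    (forall A, G A -> P (A `&` E) = P A * P E)%E ->
  forall A, <<s G >> A -> (P (A `&` E) = P A * P E)%E.
Proof.
move=> GI Gm mE GE A.
rewrite -setI_closed_g_dynkin_g_sigma_algebra//.
suff: <<d G >> `<=` [set A | measurable A /\ (P (A `&` E) = P A * P E)%E].
  by move=> /[apply] -[].
apply: smallest_sub; last by move=> B GB; split; [exact: Gm|exact: GE].
split.
- by split; rewrite // setTI probability_setT mul1e.
- move=> B [mB BE]; split; first exact: measurableC.
  rewrite setIC -setDE measureD//; last first.
    by rewrite (le_lt_trans (probability_le1 P mE))// ltry.
  transitivity (P E - P B * P E)%E; first by congr (_ - _)%E; rewrite setIC.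
  rewrite probability_setC// muleBl ?mul1e//.
  by rewrite fin_num_measure.
- move=> F tF FE; have mF n : measurable (F n) by case: (FE n).
  split; first exact: bigcup_measurable.
  rewrite setI_bigcupl (measure_bigcup P)//=; last 2 first.
    by move=> n _; exact: measurableI.
    by under eq_fun do rewrite setIC; exact: trivIset_setIl.
  rewrite (measure_bigcup P)//.
  have /fineK EE : P E \is a fin_num by rewrite fin_num_measure.
  rewrite muleC -EE -nneseriesZl//; apply: eq_eseriesr => n _.
  by rewrite EE muleC; case: (FE n).
Qed.

Lemma indep_mean (G : set (set T)) (Z W : T -> R) :
    measurable_fun [set: g_sigma_algebraType G]
      (Z : g_sigma_algebraType G -> R) ->
    indep_systems P <<s G >> (sigma_rv W) ->
    Z \in Lfun P 1%E -> W \in Lfun P 1%E ->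
  (Z \* W \in Lfun P 1%E) /\ mean P (Z \* W) = mean P Z * mean P W.
Proof.
move=> mZ GW Z1 W1.
have mfunL1 X : X \in Lfun P 1%E -> measurable_fun setT X.
  by move=> /Lfun1_integrable/integrableP[/measurable_EFinP].
pose Z' : {RV P >-> R} :=
  HB.pack Z (isMeasurableFun.Build _ _ _ _ _ (mfunL1 _ Z1)).
pose W' : {RV P >-> R} :=
  HB.pack W (isMeasurableFun.Build _ _ _ _ _ (mfunL1 _ W1)).
have ZW : indep_systems P (sigma_rv Z') (sigma_rv W').
  move=> A B [C mC <-] WB; apply: GW => //.
  exact: (mZ measurableT C mC).
have [ZW1 EZW] := indep_Lfun1M ZW Z1 W1; split => //.
by rewrite /mean EZW fineM// expectation_fin_num.
Qed.

End Independence.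

(** * The information available at time k *)

Section Past.
Context (d : measure_display) (T : measurableType d) (R : realType).
Context (P : probability T R) (N : nat).
Context (eps : nat -> {RV P >-> R}) (x0 : {RV P >-> R}).

(** A pi-system generating the sigma-algebra of x0, eps_0, ..., eps_k. It
    consists of rectangles, whose probabilities are products by the two
    independence hypotheses. *)
Definition past (k : nat) : set (set T) :=
  [set A | exists B : nat -> set R, (forall j, measurable (B j)) /\
     exists2 B0 : set R, measurable B0 &
       A = x0 @^-1` B0 `&` \bigcap_(j < k.+1) eps j @^-1` B j].

Lemma setI_closed_past k : setI_closed (past k).
Proof.
move=> _ _ [B [mB [B0 mB0 ->]]] [C [mC [C0 mC0 ->]]].
exists (fun j => B j `&` C j); split; first by move=> j; exact: measurableI.
exists (B0 `&` C0); first exact: measurableI.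
rewrite setIACA preimage_setI -bigcapI.
by congr (_ `&` _); apply: eq_bigcapr => j _; rewrite preimage_setI.
Qed.

Lemma past_measurable k : past k `<=` measurable.
Proof.
move=> _ [B [mB [B0 mB0 ->]]]; apply: measurableI.
  exact: measurable_funPTI.
by apply: bigcap_measurable => [|j _]; [exists 0%N | exact: measurable_funPTI].
Qed.

Lemma le_past k : past k `<=` past k.+1.
Proof.
move=> _ [B [mB [B0 mB0 ->]]].
exists (fun j => if (j <= k)%N then B j else setT); split.
  by move=> j; case: ifP.
exists B0 => //; congr (_ `&` _); apply/seteqP; split => w /= h j /= jk.
  by case: ifP => // /h.
by have := h j (leqW jk); rewrite -ltnS jk.
Qed.

Definition known (k : nat) (X : T -> R) :=
  measurable_fun [set: g_sigma_algebraType (past k)]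
    (X : g_sigma_algebraType (past k) -> R).

Lemma knownS k X : known k X -> known k.+1 X.
Proof.
move=> mX _ B mB; apply: (sub_sigma_algebra2 (@le_past k)).
exact: (mX measurableT).
Qed.

Lemma known_x0 : known 0 x0.
Proof.
move=> _ B mB; apply: sub_sigma_algebra.
exists (fun=> setT); split => //; exists B => //.
by rewrite setTI; apply/seteqP; split => w //= [].
Qed.

Lemma known_eps k : known k (eps k).
Proof.
move=> _ B mB; apply: sub_sigma_algebra.
exists (fun j => if j == k then B else setT); split.
  by move=> j; case: ifP.
exists setT => //; apply/seteqP; split => w /=.
  by move=> [_ Bw]; split => // j /= _; case: eqP => [->|].
by move=> [_ /(_ k)/= /(_ (ltnSn k))]; rewrite eqxx.
Qed.

Hypothesis eps_indep : mutually_indep P N eps.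
Hypothesis x0_indep : indep_systems P (sigma_rv x0) (sigma_process N eps).

Let bigcap_eps k (B : nat -> set R) : (forall j, measurable (B j)) ->
  (k <= N)%N ->
  P (\bigcap_(j < k.+1) eps j @^-1` B j)
    = (\prod_(j < k.+1) P (eps j @^-1` B j))%E.
Proof.
(* The product rule is given for the times 0, ..., N only: pad with the sure
   event. *)
move=> mB kN; pose C j := if (j <= k)%N then B j else setT.
have mC j : measurable (C j) by rewrite /C; case: ifP.
have -> : \bigcap_(j < k.+1) eps j @^-1` B j =
    \bigcap_(j < N.+1) eps j @^-1` C j.
  apply/seteqP; split => w /= h j /= jk; rewrite /C.
    by case: ifP => // /h.
  by have := h j (leq_trans jk (kN : (k < N.+1)%N)); rewrite /C -ltnS jk.
rewrite eps_indep// -(big_mkord xpredT (fun j => P (eps j @^-1` C j))).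
rewrite (big_cat_nat _ (n := k.+1))//= [X in (_ * X)%E]big1_seq ?mule1.
  by rewrite big_mkord; apply: eq_bigr => j _; rewrite /C -ltnS ltn_ord.
move=> j; rewrite mem_index_iota => /andP[_ /andP[kj _]].
by rewrite /C leqNgt kj preimage_setT probability_setT.
Qed.

Let sigma_bigcap_eps k (B : nat -> set R) : (forall j, measurable (B j)) ->
  (k <= N)%N -> sigma_process N eps (\bigcap_(j < k.+1) eps j @^-1` B j).
Proof.
move=> mB kN.
pose G := [set A | exists2 k, (k <= N)%N & sigma_rv (eps k) A].
suff : measurable
    ((\bigcap_(j < k.+1) eps j @^-1` B j) : set (g_sigma_algebraType G)) by [].
apply: bigcap_measurable => [|j /= jk]; first by exists 0%N.
apply: sub_sigma_algebra; exists j; first by rewrite (leq_trans _ kN).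
by exists (B j) => //; rewrite setTI.
Qed.

(** On a rectangle, the event on eps_(k+1) is one more factor of the product
    rule for the noise, and x0 factors out of both sides. *)
Lemma past_indep k : (k < N)%N ->
  indep_systems P <<s past k>> (sigma_rv (eps k.+1)).
Proof.
move=> kN A _ + [C mC <-]; rewrite setTI.
apply: indep_event_sigma.
- exact: setI_closed_past.
- exact: past_measurable.
- exact: measurable_funPTI.
move=> _ [B [mB [B0 mB0 ->]]].
pose B' j := if (j <= k)%N then B j else C.
have mB' j : measurable (B' j) by rewrite /B'; case: ifP.
have E : \bigcap_(j < k.+1) eps j @^-1` B j `&` eps k.+1 @^-1` C =
         \bigcap_(j < k.+2) eps j @^-1` B' j.
  apply/seteqP; split => w /=.
    move=> [h hC] j /= jk; rewrite /B'; case: ifP => // [/h//|].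
    by move: jk; rewrite ltnS leq_eqVlt => /predU1P[->//|]; rewrite ltnS => ->.
  move=> h; split=> [j /= jk|].
    by have := h j (leqW jk); rewrite /B' -ltnS jk.
  by have := h k.+1 (ltnSn _); rewrite /B' ltnn.
have x0B : sigma_rv x0 (x0 @^-1` B0) by exists B0 => //; rewrite setTI.
rewrite -setIA E !x0_indep//;
  [|exact: sigma_bigcap_eps (ltnW _)|exact: sigma_bigcap_eps].
rewrite !bigcap_eps//; last exact: ltnW.
rewrite [in LHS]big_ord_recr /= /B' ltnn muleA.
by under eq_bigr => j _ do rewrite -ltnS ltn_ord.
Qed.

Lemma known_meanM k (Z : T -> R) (f : R -> R) : (k < N)%N -> known k Z ->
    measurable_fun setT f -> Z \in Lfun P 1%E -> f \o eps k.+1 \in Lfun P 1%E ->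
  (Z \* (f \o eps k.+1) \in Lfun P 1%E) /\
  mean P (Z \* (f \o eps k.+1)) = mean P Z * mean P (f \o eps k.+1).
Proof.
move=> kN mZ mf Z1 f1; apply: indep_mean => //; first exact: mZ.
move=> A _ sA [C mC <-]; apply: (past_indep kN) => //.
by exists (f @^-1` C); rewrite ?setTI// -[f @^-1` C]setTI; exact: mf.
Qed.

End Past.

(** * First-order conditions for the gains *)

Section Gain_equations.
Context (R : realType) (n : nat).

(** With t_i = s_i b_i >= 0, a row vector v in the kernel is determined by the
    number S = sum_i v_i c_i, through v_i = - S b_i (1 + t_i). Reinserting
    this gives S (1 + sum_i t_i) = 0. Both kinds of vectors c of the game have
    this form: s_i is alpha_i b_i / r_i for the variance, and the cube root of
    alphabar_i b_i / rbar_i for the mean. *)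
Lemma E_mx_unit (b : 'I_n -> nat -> R) (s : 'I_n -> R) (c : 'cV[R]_n) k :
    (forall i, 0 <= s i * b i k) ->
    (forall i, c i 0 = s i / (1 + s i * b i k)) ->
  E_mx b c k \in unitmx.
Proof.
move=> sb cE; rewrite -row_free_unit; apply: inj_row_free => v vE.
pose S := \sum_i v 0 i * c i 0.
have den i : 1 + s i * b i k != 0 by rewrite gt_eqF// ltr_pwDl.
have vi i : v 0 i = - S * b i k * (1 + s i * b i k).
  have /rowP/(_ i) := vE; rewrite !mxE => vEi.
  have Si : S = v 0 i * c i 0 + \sum_(j | j != i) v 0 j * c j 0.
    by rewrite /S (bigD1 i).
  move: vEi; rewrite (bigD1 i)//= mxE eqxx mulr1.
  under eq_bigr => j ji do rewrite mxE (negPf ji) mulrA.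
  rewrite -mulr_suml => vEi.
  have {}vEi : v 0 i = - (S - v 0 i * c i 0) * b i k.
    rewrite Si addrC addKr; apply/eqP.
    by rewrite -subr_eq0 mulNr opprK; apply/eqP.
  have ci : c i 0 * (1 + s i * b i k) = s i by rewrite cE divfK.
  have : v 0 i * (1 + s i * b i k) =
      - (S * (1 + s i * b i k) - v 0 i * (c i 0 * (1 + s i * b i k))) * b i k.
    by rewrite {1}vEi; ring.
  by rewrite ci => h; lra.
have S0 : S * (1 + \sum_i s i * b i k) = 0.
  rewrite mulrDr mulr1 mulr_sumr {1}/S -big_split big1//= => i _.
  by rewrite vi cE mulrA -[_ * s i]mulrA mulrAC; field; exact: den.
have {}S0 : S = 0.
  move/eqP: S0; rewrite mulf_eq0 => /orP[/eqP//|].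
  by rewrite gt_eqF// ltr_pwDl// sumr_ge0.
by apply/rowP => i; rewrite vi S0 mxE oppr0 !mul0r.
Qed.

(** Row i of the system reads g_i + c_i sum_(j != i) b_j g_j = c_i; multiplied
    by 1 + s_i b_i it becomes an equation in which the sum runs over all j. *)
Lemma E_mx_solution (b : 'I_n -> nat -> R) (s : 'I_n -> R) (c : 'cV[R]_n) k :
    (forall i, 0 <= s i * b i k) ->
    (forall i, c i 0 = s i / (1 + s i * b i k)) ->
  let g := invmx (E_mx b c k) *m c in
  forall i, g i 0 = s i * (1 - \sum_j g j 0 * b j k).
Proof.
move=> sb cE g i.
have den : 1 + s i * b i k != 0 by rewrite gt_eqF// ltr_pwDl.
have /colP/(_ i) : E_mx b c k *m g = c by rewrite mulKVmx// (E_mx_unit sb cE).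
rewrite mxE (bigD1 i)//= mxE eqxx mul1r.
under eq_bigr => j ji do rewrite mxE eq_sym (negPf ji) -mulrA.
rewrite -mulr_sumr => gE; rewrite (bigD1 i)//=.
under eq_bigr => j ji do rewrite mulrC.
move: gE; move: (\sum_(j < n | _) _) => S gE.
have ci : c i 0 * (1 + s i * b i k) = s i by rewrite cE divfK.
have : (g i 0 + c i 0 * S) * (1 + s i * b i k) = c i 0 * (1 + s i * b i k).
  by rewrite gE.
rewrite mulrDl mulrAC ci => h; lra.
Qed.

Lemma cbrtX3 (x : R) : cbrt x ^+ 3 = x.
Proof.
rewrite /cbrt exprMn -(powR_mulrn 3 (powR_ge0 _ _)) -powRrM mulVf// powRr1//.
rewrite exprS sqr_sg.
have [->|x0] := eqVneq x 0; first by rewrite sgr0 normr0 mulr0.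
by rewrite mulr1 -numEsg.
Qed.

Lemma cbrtM_ge0 (x y : R) : 0 <= x * y -> 0 <= cbrt x * y.
Proof.
move=> xy; rewrite /cbrt mulrAC mulr_ge0 ?powR_ge0//.
have [x0|x0|->] := ltrgt0P x; last by rewrite sgr0 mul0r.
  by rewrite gtr0_sg// mul1r -(pmulr_rge0 _ x0).
by rewrite ltr0_sg// mulN1r oppr_ge0 -(nmulr_rge0 _ x0).
Qed.

Lemma gain_foc (b r alpha : 'I_n -> nat -> R) k :
    (forall i, 0 < r i k) -> (forall i, 0 <= alpha i k.+1) ->
  forall i, r i k * gain b r alpha k i
    = alpha i k.+1 * b i k * (1 - \sum_j gain b r alpha k j * b j k).
Proof.
move=> r0 alpha0 i; pose s i := alpha i k.+1 * b i k / r i k.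
have sb j : 0 <= s j * b j k.
  rewrite /s mulrAC -(mulrA (alpha j k.+1)) -expr2.
  by apply: divr_ge0; [apply: mulr_ge0; rewrite ?sqr_ge0|exact: ltW].
rewrite /gain {1}(@E_mx_solution b s _ _ sb).
  by rewrite /s; field; rewrite gt_eqF.
move=> j; rewrite mxE /s; have := r0 j; have := sb j; rewrite /s => ? ?.
have ? : 0 <= alpha j k.+1 * b j k ^+ 2 by rewrite mulr_ge0 ?sqr_ge0.
by field; rewrite -mulrA -expr2 !gt_eqF//= ltr_pwDl.
Qed.

Lemma gainbar_foc (b rbar alphabar : 'I_n -> nat -> R) k :
    (forall i, 0 < rbar i k) -> (forall i, 0 <= alphabar i k.+1) ->
  forall i, rbar i k * gainbar b rbar alphabar k i ^+ 3
    = alphabar i k.+1 * b i k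
      * (1 - \sum_j gainbar b rbar alphabar k j * b j k) ^+ 3.
Proof.
move=> r0 alpha0 i; pose s i := cbrt (alphabar i k.+1 * b i k / rbar i k).
have sb j : 0 <= s j * b j k.
  apply: cbrtM_ge0.
  rewrite mulrAC -(mulrA (alphabar j k.+1)) -expr2.
  by apply: divr_ge0; [apply: mulr_ge0; rewrite ?sqr_ge0|exact: ltW].
rewrite /gainbar {1}(@E_mx_solution b s _ _ sb); last by move=> j; rewrite mxE.
by rewrite exprMn cbrtX3; field; rewrite gt_eqF.
Qed.

End Gain_equations.

(** * Means and covariances *)

Section Moments.
Context (d : measure_display) (T : measurableType d) (R : realType).
Context (P : probability T R).

(** Integrability and the value of the mean are carried together, so that the
    mean of a polynomial expression is computed along its syntax. *)
Definition has_mean (X : T -> R) (m : R) := X \in Lfun P 1%E /\ mean P X = m.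

Lemma has_mean_Lfun (X : T -> R) : X \in Lfun P 1%E -> has_mean X (mean P X).
Proof. by []. Qed.

Lemma has_meanE (X : T -> R) m : has_mean X m -> ('E_P[X] = m%:E)%E.
Proof. by move=> [X1 <-]; rewrite fineK// expectation_fin_num. Qed.

Lemma has_meanD (X Y : T -> R) a b : has_mean X a -> has_mean Y b ->
  has_mean (fun w => X w + Y w) (a + b).
Proof.
move=> /[dup] hX [X1 _] /[dup] hY [Y1 _]; split.
  exact: (rpredD X1 Y1).
by rewrite /mean (expectationD X1 Y1) (has_meanE hX) (has_meanE hY).
Qed.

Lemma has_meanZ (X : T -> R) c a : has_mean X a ->
  has_mean (fun w => c * X w) (c * a).
Proof.
move=> /[dup] hX [X1 _].
have -> : (fun w => c * X w) = c \o* X by apply/funext => w /=; rewrite mulrC.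
split; first exact: Lfun_scale.
by rewrite /mean (expectationZl _ X1) (has_meanE hX).
Qed.

Lemma has_mean_cst c : has_mean (fun=> c) c.
Proof.
split; first exact: (Lfun_cst P c 1).
by rewrite /mean [X in expectation P X](_ : _ = cst c)// expectation_cst.
Qed.

Lemma Lfun_measurable p (X : T -> R) : X \in Lfun P p -> measurable_fun setT X.
Proof. by rewrite inE => /andP[/[!inE]]. Qed.

Lemma Lfun2_Lfun1 (X : T -> R) : X \in Lfun P 2%:E -> X \in Lfun P 1%E.
Proof. by apply: Lfun_subset12; exact: fin_num_measure. Qed.

Lemma Lfun2_sqr (X : T -> R) : measurable_fun setT X ->
  (fun w => X w ^+ 2) \in Lfun P 1%E -> X \in Lfun P 2%:E.
Proof.
move=> mX /Lfun1_integrable/integrableP[_ X2].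
rewrite inE; apply/andP; split; rewrite inE//=.
rewrite /finite_norm unlock /Lnorm poweR_lty//.
move: X2; congr (_ < _)%E; apply: eq_integral => w _ /=.
by rewrite normrX powR_mulrn.
Qed.

Lemma Lfun2M (X Y : T -> R) : X \in Lfun P 2%:E -> Y \in Lfun P 2%:E ->
  (fun w => X w * Y w) \in Lfun P 1%E.
Proof. exact: Lfun2_mul_Lfun1. Qed.

Lemma Lfun2D (X Y : T -> R) : X \in Lfun P 2%:E -> Y \in Lfun P 2%:E ->
  (fun w => X w + Y w) \in Lfun P 2%:E.
Proof. by move=> X2 Y2; apply: (rpredD X2 Y2) => //; rewrite lee1n. Qed.

Lemma Lfun2Z (X : T -> R) c : X \in Lfun P 2%:E ->
  (fun w => c * X w) \in Lfun P 2%:E.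
Proof.
move=> X2.
have -> : (fun w => c * X w) = c \o* X by apply/funext => w /=; rewrite mulrC.
by apply: Lfun_scale => //; rewrite ler1n.
Qed.

Definition centered (X : T -> R) : T -> R := fun w => X w - mean P X.

Definition cov (X Y : T -> R) : R :=
  mean P (fun w => centered X w * centered Y w).

Lemma centered_Lfun2 (X : T -> R) : X \in Lfun P 2%:E ->
  centered X \in Lfun P 2%:E.
Proof. by move=> X2; apply: Lfun2D => //; exact: Lfun_cst. Qed.

Lemma has_mean_centered (X : T -> R) : X \in Lfun P 1%E ->
  has_mean (centered X) 0.
Proof.
move=> X1; rewrite -(subrr (mean P X)).
by apply: has_meanD; [exact: has_mean_Lfun|exact: has_mean_cst].
Qed.

Lemma has_cov (X Y : T -> R) : X \in Lfun P 2%:E -> Y \in Lfun P 2%:E ->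
  has_mean (fun w => centered X w * centered Y w) (cov X Y).
Proof.
by move=> X2 Y2; apply: has_mean_Lfun; apply: Lfun2M; exact: centered_Lfun2.
Qed.

Lemma variance_cov (X : T -> R) : X \in Lfun P 2%:E ->
  ('V_P[X] = (cov X X)%:E)%E.
Proof. by move=> X2; rewrite -(has_meanE (has_cov X2 X2)) /variance unlock. Qed.

Lemma variance_lty (X : T -> R) : X \in Lfun P 1%E -> ('V_P[X] < +oo)%E ->
  X \in Lfun P 2%:E.
Proof.
move=> X1 Voo.
have mX := Lfun_measurable X1.
have mD : measurable_fun setT (centered X) by exact: measurable_funB.
have mD2 : measurable_fun setT (fun w => centered X w ^+ 2).
  exact: measurable_funX.
have D2 : centered X \in Lfun P 2%:E.
  apply: Lfun2_sqr => //; apply/Lfun1_integrable/integrableP; split.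
    exact/measurable_EFinP.
  move: Voo; rewrite /variance unlock unlock; congr (_ < _)%E.
  apply: eq_integral => w _ /=.
  by rewrite ger0_norm ?sqr_ge0// expr2 /centered /mean unlock.
have -> : X = fun w => centered X w + mean P X.
  by apply/funext => w; rewrite subrK.
by apply: Lfun2D => //; exact: Lfun_cst.
Qed.

(** The polynomial in the conclusion is the second moment of
    U - E[U] + G (X - E[X]). *)
Lemma cov_square_ge0 (X U : T -> R) G :
    X \in Lfun P 2%:E -> U \in Lfun P 2%:E ->
  0 <= cov U U + 2 * G * cov X U + G ^+ 2 * cov X X.
Proof.
move=> X2 U2.
have h : has_mean (fun w => (centered U w + G * centered X w) ^+ 2)
  (cov U U + 2 * G * cov X U + G ^+ 2 * cov X X).
  rewrite [X in has_mean X _](_ : _ = fun w =>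
    (centered U w * centered U w + 2 * G * (centered X w * centered U w))
    + G ^+ 2 * (centered X w * centered X w)); last first.
    by apply/funext => w; ring.
  apply: has_meanD; last by apply: has_meanZ; exact: has_cov.
  by apply: has_meanD; [exact: has_cov|apply: has_meanZ; exact: has_cov].
by rewrite -lee_fin -(has_meanE h) expectation_ge0// => w; exact: sqr_ge0.
Qed.

Lemma affine_cov (X : T -> R) c e : X \in Lfun P 2%:E ->
  let U := fun w => c * centered X w + e in
  [/\ U \in Lfun P 2%:E, mean P U = e, cov X U = c * cov X X &
      cov U U = c ^+ 2 * cov X X].
Proof.
move=> X2 U.
have mU : mean P U = e.
  rewrite -[RHS]add0r -[X in X + _](mulr0 c).
  suff : has_mean U (c * 0 + e) by case.
  apply: has_meanD; last exact: has_mean_cst.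
  by apply: has_meanZ; apply: has_mean_centered; exact: Lfun2_Lfun1.
have cU : centered U = fun w => c * centered X w.
  by apply/funext => w; rewrite {1}/centered mU /U addrK.
split=> //.
- apply: Lfun2D; first exact/Lfun2Z/centered_Lfun2.
  exact: Lfun_cst.
- have [_ <-] := has_meanZ c (has_cov X2 X2).
  by rewrite /cov cU; congr mean; apply/funext => w; ring.
- have [_ <-] := has_meanZ (c ^+ 2) (has_cov X2 X2).
  by rewrite /cov cU; congr mean; apply/funext => w; ring.
Qed.

End Moments.

(** * One step of the dynamics *)

Section One_step.
Context (d : measure_display) (T : measurableType d) (R : realType).
Context (P : probability T R) (N : nat).
Context (eps : nat -> {RV P >-> R}) (x0 : {RV P >-> R}).
Hypothesis eps_sq : forall k, (k <= N)%N -> (eps k : T -> R) \in Lfun P 2%:E.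
Hypothesis eps_mean : forall k, (k <= N)%N -> ('E_P[eps k] = 0)%E.
Hypothesis eps_indep : mutually_indep P N eps.
Hypothesis x0_indep : indep_systems P (sigma_rv x0) (sigma_process N eps).

Let known := known eps x0.

Definition next_state (A Abar b : R) (X U W : T -> R) : T -> R :=
  fun w => A * centered P X w + Abar * mean P X + b * U w
           + centered P X w * W w.

Lemma known_centered k X : known k X -> known k (centered P X).
Proof. by move=> kX; exact: measurable_funB. Qed.

Lemma noise_mean k Z : (k < N)%N -> known k Z -> Z \in Lfun P 1%E ->
  has_mean P (fun w => Z w * eps k.+1 w) 0.
Proof.
move=> kN kZ Z1.
have [|L E] :=
  known_meanM eps_indep x0_indep kN kZ (@measurable_id _ _ setT) Z1.
  exact: Lfun2_Lfun1 (eps_sq kN).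
split; first exact: L.
by rewrite E /mean /= eps_mean// mulr0.
Qed.

Lemma next_mean k A Abar b X U : (k < N)%N -> known k X ->
    X \in Lfun P 1%E -> U \in Lfun P 1%E ->
  has_mean P (next_state A Abar b X U (eps k.+1))
    (Abar * mean P X + b * mean P U).
Proof.
move=> kN kX X1 U1; have hX := has_mean_centered X1.
have -> : Abar * mean P X + b * mean P U =
    A * 0 + Abar * mean P X + b * mean P U + 0 by ring.
apply: has_meanD; last first.
  by apply: noise_mean => //; [exact: known_centered|exact: hX.1].
apply: has_meanD; last exact/has_meanZ/has_mean_Lfun.
by apply: has_meanD; [exact: has_meanZ|exact: has_mean_cst].
Qed.

(** Among the terms of the square of the centered next state, the cross terms
    with the noise vanish since eps_(k+1) is centered and independent of the
    past, and the squared noise term factors for the same reason. *)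
Lemma next_cov k A Abar b X U : (k < N)%N -> known k X -> known k U ->
    X \in Lfun P 2%:E -> U \in Lfun P 2%:E ->
  let X' := next_state A Abar b X U (eps k.+1) in
  X' \in Lfun P 2%:E /\
  cov P X' X' = A ^+ 2 * cov P X X + 2 * A * b * cov P X U + b ^+ 2 * cov P U U
    + mean P (fun w => eps k.+1 w ^+ 2) * cov P X X.
Proof.
move=> kN kX kU X2 U2 X'.
have [X1 U1] := (Lfun2_Lfun1 X2, Lfun2_Lfun1 U2).
have [X'1 mX'] := next_mean A Abar b kN kX X1 U1.
have cX' w : centered P X' w = A * centered P X w + b * centered P U w
    + centered P X w * eps k.+1 w.
  by rewrite /centered mX' /X' /next_state /centered; ring.
have kcX := known_centered kX; have kcU := known_centered kU.
have kY : known k (fun w => A * centered P X w + b * centered P U w).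
  by apply: measurable_funD; apply: measurable_funM.
have cX2 := centered_Lfun2 X2; have cU2 := centered_Lfun2 U2.
have Y2 : (fun w => A * centered P X w + b * centered P U w) \in Lfun P 2%:E.
  by apply: Lfun2D; exact: Lfun2Z.
have msqr : measurable_fun [set: R] (fun x : R => x ^+ 2).
  exact: measurable_funX.
have [|L E] := known_meanM eps_indep x0_indep kN (measurable_funM kcX kcX) msqr
    (has_cov X2 X2).1.
  exact: Lfun2M (eps_sq kN) (eps_sq kN).
have h : has_mean P (fun w => centered P X' w * centered P X' w)
  (A ^+ 2 * cov P X X + 2 * A * b * cov P X U + b ^+ 2 * cov P U U
    + mean P (fun w => eps k.+1 w ^+ 2) * cov P X X).
  rewrite [X in has_mean P X _](_ : _ = fun w =>
      A ^+ 2 * (centered P X w * centered P X w)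
      + 2 * A * b * (centered P X w * centered P U w)
      + b ^+ 2 * (centered P U w * centered P U w)
      + 2 * (((A * centered P X w + b * centered P U w) * centered P X w)
             * eps k.+1 w)
      + (centered P X w * centered P X w) * eps k.+1 w ^+ 2); last first.
    by apply/funext => w; rewrite cX'; ring.
  (* The summand 2 * 0 stands for the cross terms with the noise. *)
  rewrite (_ : _ + _ * cov P X X = A ^+ 2 * cov P X X + 2 * A * b * cov P X U
      + b ^+ 2 * cov P U U + 2 * 0
      + cov P X X * mean P (fun w => eps k.+1 w ^+ 2));
    last by ring.
  apply: has_meanD; last first.
    by split; [exact: L|exact: E].
  apply: has_meanD; last first.
    apply: has_meanZ; apply: noise_mean => //; first exact: measurable_funM.
    exact: Lfun2M.
  apply: has_meanD; last by apply: has_meanZ; exact: has_cov.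
  by apply: has_meanD; apply: has_meanZ; exact: has_cov.
split; last exact: h.2.
have mX2 : centered P X' \in Lfun P 2%:E.
  apply: Lfun2_sqr.
    by apply: measurable_funB => //; exact: Lfun_measurable X'1.
  by under eq_fun => w do rewrite expr2; exact: h.1.
have -> : X' = fun w => centered P X' w + mean P X'.
  by apply/funext => w; rewrite subrK.
by apply: Lfun2D => //; exact: Lfun_cst.
Qed.

End One_step.

Section One_step_cost.
Context (R : realFieldType).

(** V, C and U are the variance of the state, its covariance with the control
    and the variance of the control. By the first-order condition the
    difference of the two sides is (r + al b^2) (U + 2 G C + G^2 V). *)
Lemma quadratic_step (r al A b G V C U : R) :
    0 <= r + al * b ^+ 2 -> r * G = al * b * (A - b * G) ->
    0 <= U + 2 * G * C + G ^+ 2 * V ->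
  (r * G ^+ 2 + al * (A - b * G) ^+ 2) * V
    <= r * U + al * (A ^+ 2 * V + 2 * A * b * C + b ^+ 2 * U).
Proof.
move=> r0 foc sq; rewrite -subr_ge0.
have -> : r * U + al * (A ^+ 2 * V + 2 * A * b * C + b ^+ 2 * U)
    - (r * G ^+ 2 + al * (A - b * G) ^+ 2) * V
  = (r + al * b ^+ 2) * (U + 2 * G * C + G ^+ 2 * V)
    - 2 * (C + G * V) * (r * G - al * b * (A - b * G)) by ring.
by rewrite foc subrr mulr0 subr0 mulr_ge0.
Qed.

Lemma quartic_tangent (y z : R) : z ^+ 4 + 4 * z ^+ 3 * (y - z) <= y ^+ 4.
Proof.
rewrite -subr_ge0.
have -> : y ^+ 4 - (z ^+ 4 + 4 * z ^+ 3 * (y - z))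
  = (y - z) ^+ 2 * ((y + z) ^+ 2 + 2 * z ^+ 2) by ring.
by rewrite mulr_ge0 ?sqr_ge0// addr_ge0 ?sqr_ge0// mulr_ge0// sqr_ge0.
Qed.

(** Both fourth powers on the right are bounded below by their tangents at the
    candidate y = - G m; by the first-order condition the linear terms in
    y + G m cancel. *)
Lemma quartic_step (r al A b G m y : R) :
    0 <= r -> 0 <= al -> r * G ^+ 3 = al * b * (A - b * G) ^+ 3 ->
  (r * G ^+ 4 + al * (A - b * G) ^+ 4) * m ^+ 4
    <= r * y ^+ 4 + al * (A * m + b * y) ^+ 4.
Proof.
move=> r0 al0 foc.
have h1 := ler_wpM2l r0 (quartic_tangent y (- G * m)).
have h2 := ler_wpM2l al0 (quartic_tangent (A * m + b * y) ((A - b * G) * m)).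
apply: le_trans (lerD h1 h2); rewrite le_eqVlt; apply/orP; left; apply/eqP.
have -> : r * ((- G * m) ^+ 4 + 4 * (- G * m) ^+ 3 * (y - - G * m))
    + al * (((A - b * G) * m) ^+ 4
            + 4 * ((A - b * G) * m) ^+ 3 * (A * m + b * y - (A - b * G) * m))
  = (r * G ^+ 4 + al * (A - b * G) ^+ 4) * m ^+ 4
    - 4 * m ^+ 3 * (y + G * m)
      * (r * G ^+ 3 - al * b * (A - b * G) ^+ 3) by ring.
by rewrite foc subrr mulr0 subr0.
Qed.

End One_step_cost.

(** * Costs in terms of moments *)

Section Cost.
Context (d : measure_display) (T : measurableType d) (R : realType).
Context (P : probability T R) (n N : nat).
Context (a : nat -> R) (b q qbar r rbar : 'I_n -> nat -> R).
Context (eps : nat -> T -> R) (x0 : T -> R).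
Context (u : 'I_n -> strategy R) (i : 'I_n).

Let S := state P a b eps x0 u.
Let C := control P a b eps x0 u i.

Definition stage_cost (k : nat) : R :=
  q i k * cov P (S k) (S k) + qbar i k * mean P (S k) ^+ 4
  + r i k * cov P (C k) (C k) + rbar i k * mean P (C k) ^+ 4.

Lemma costE :
    (forall k, (k <= N)%N -> S k \in Lfun P 2%:E) ->
    (forall k, (k < N)%N -> C k \in Lfun P 2%:E) ->
  cost P N a b q qbar r rbar eps x0 u i =
  (q i N * cov P (S N) (S N) + qbar i N * mean P (S N) ^+ 4
   + \sum_(0 <= k < N) stage_cost k)%:E.
Proof.
move=> S2 C2; rewrite /cost -/S variance_cov; last exact: S2.
rewrite [RHS]EFinD EFinD EFinM -sumEFin; congr (_ + _)%E.
apply: eq_big_nat => k /andP[_ kN].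
by rewrite !variance_cov ?(S2 _ (ltnW kN)) ?C2.
Qed.

Hypothesis q_gt0 : forall k, (k <= N)%N -> 0 < q i k.
Hypothesis qbar_gt0 : forall k, (k <= N)%N -> 0 < qbar i k.
Hypothesis r_gt0 : forall k, (k < N)%N -> 0 < r i k.
Hypothesis rbar_gt0 : forall k, (k < N)%N -> 0 < rbar i k.

Let weighted_lty (c : R) (v x : \bar R) :
  ((0 < c)%R -> 0 <= v -> c%:E * v <= x -> x < +oo -> v < +oo)%E.
Proof.
move=> c0 v0 vx xoo; rewrite ltNge leye_eq; apply/negP => /eqP voo.
move: vx; rewrite voo gt0_muley ?lte_fin// leye_eq => /eqP xE.
by rewrite xE ltxx in xoo.
Qed.

(** All the terms of the cost are nonnegative and the weights of the variances
    are positive, so a finite cost forces finite variances. *)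
Lemma cost_lty_Lfun2 : cost_defined P N a b eps x0 u i ->
    (cost P N a b q qbar r rbar eps x0 u i < +oo)%E ->
  forall k, (k < N)%N -> S k \in Lfun P 2%:E /\ C k \in Lfun P 2%:E.
Proof.
move=> [S1 C1] coo k kN.
pose e j : \bar R := ((q i j)%:E * 'V_P[S j] + (qbar i j * mean P (S j) ^+ 4)%:E
        + (r i j)%:E * 'V_P[C j] + (rbar i j * mean P (C j) ^+ 4)%:E)%E.
have qV0 j : (j <= N)%N -> (0 <= (q i j)%:E * 'V_P[S j])%E.
  by move=> jN; rewrite mule_ge0 ?variance_ge0// lee_fin ltW ?q_gt0.
have rV0 j : (j < N)%N -> (0 <= (r i j)%:E * 'V_P[C j])%E.
  by move=> jN; rewrite mule_ge0 ?variance_ge0// lee_fin ltW ?r_gt0.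
have qm0 j : (j <= N)%N -> (0 <= (qbar i j * mean P (S j) ^+ 4)%:E)%E.
  by move=> jN; rewrite lee_fin mulr_ge0 ?exprn_even_ge0// ltW ?qbar_gt0.
have rm0 j : (j < N)%N -> (0 <= (rbar i j * mean P (C j) ^+ 4)%:E)%E.
  by move=> jN; rewrite lee_fin mulr_ge0 ?exprn_even_ge0// ltW ?rbar_gt0.
have e0 j : (j < N)%N -> (0 <= e j)%E.
  by move=> jN; rewrite /e !adde_ge0 ?qV0 ?rV0 ?qm0 ?rm0// ltnW.
have ek : (e k < +oo)%E.
  apply: le_lt_trans coo; rewrite /cost -/S -/C.
  apply: (@le_trans _ _ (\sum_(0 <= j < N) e j)%E).
    rewrite (bigD1_seq k)/= ?mem_index_iota ?iota_uniq// leeDl//.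
    rewrite big_seq_cond sume_ge0// => j /andP[].
    by rewrite mem_index_iota => /e0.
  by rewrite leeDr// adde_ge0 ?qV0 ?qm0.
have kN' := ltnW kN.
split; apply: variance_lty.
- by apply/Lfun1_integrable; exact: S1.
- apply: (weighted_lty (q_gt0 kN') (variance_ge0 _ _) _ ek).
  by rewrite /e -!addeA leeDl// !adde_ge0 ?rV0 ?qm0 ?rm0.
- by apply/Lfun1_integrable; exact: C1.
- apply: (weighted_lty (r_gt0 kN) (variance_ge0 _ _) _ ek).
  by rewrite /e addeAC leeDr// !adde_ge0 ?qV0 ?qm0 ?rm0.
Qed.

End Cost.

(** * The value function and the equilibrium *)

Section Equilibrium.
Context (R : realType) (d : measure_display).
Context (T : measurableType d) (P : probability T R) (n N : nat).
Context (a : nat -> R) (b q qbar r rbar : 'I_n -> nat -> R).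
Context (eps : nat -> {RV P >-> R}) (x0 : {RV P >-> R}).
Context (alpha alphabar : 'I_n -> nat -> R).
Hypothesis hN : (1 <= N)%N.
Hypothesis hq : forall i k, (k <= N)%N -> 0 < q i k.
Hypothesis hqbar : forall i k, (k <= N)%N -> 0 < qbar i k.
Hypothesis hr : forall i k, (k < N)%N -> 0 < r i k.
Hypothesis hrbar : forall i k, (k < N)%N -> 0 < rbar i k.
Hypothesis heps_sq : forall k, (k <= N)%N -> (eps k : T -> R) \in Lfun P 2%:E.
Hypothesis heps_mean : forall k, (k <= N)%N -> ('E_P[eps k] = 0)%E.
Hypothesis heps_indep : mutually_indep P N eps.
Hypothesis hx0 : (x0 : T -> R) \in Lfun P 1%E.
Hypothesis hx0_indep : indep_systems P (sigma_rv x0) (sigma_process N eps).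
Hypothesis halphaN : forall i, alpha i N = q i N.
Hypothesis halphabarN : forall i, alphabar i N = qbar i N.

Let g k i := gain b r alpha k i.
Let gbar k i := gainbar b rbar alphabar k i.

Hypothesis halphabar : forall i k, (k < N)%N ->
  alphabar i k = qbar i k + rbar i k * (gbar k i * a k) ^+ 4
    + alphabar i k.+1 * (a k - \sum_(j < n) gbar k j * a k * b j k) ^+ 4.
Hypothesis halpha : forall i k, (k < N)%N ->
  alpha i k = q i k + r i k * (g k i * a k) ^+ 2
    + alpha i k.+1 * (a k - \sum_(j < n) g k j * a k * b j k) ^+ 2
    + alpha i k.+1 * mean P (fun w => eps k.+1 w ^+ 2).

Lemma alpha_gt0 i k : (k <= N)%N -> 0 < alpha i k.
Proof.
move=> /subnKC; move: (N - k)%N => m.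
elim: m k => [|m IH] k; first by rewrite addn0 => ->; rewrite halphaN hq.
rewrite addnS => kmN.
have kN : (k < N)%N by rewrite -kmN ltnS leq_addr.
have a0 : 0 < alpha i k.+1 by apply: IH; rewrite addSn.
rewrite halpha// -!addrA ltr_pwDl ?(hq _ (ltnW kN))// !addr_ge0//.
- by rewrite mulr_ge0 ?sqr_ge0// ltW ?hr.
- by rewrite mulr_ge0 ?sqr_ge0// ltW.
- rewrite mulr_ge0//; first exact: ltW.
  by rewrite /mean fine_ge0// expectation_ge0// => w; exact: sqr_ge0.
Qed.

Lemma alphabar_gt0 i k : (k <= N)%N -> 0 < alphabar i k.
Proof.
move=> /subnKC; move: (N - k)%N => m.
elim: m k => [|m IH] k; first by rewrite addn0 => ->; rewrite halphabarN hqbar.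
rewrite addnS => kmN.
have kN : (k < N)%N by rewrite -kmN ltnS leq_addr.
have a0 : 0 < alphabar i k.+1 by apply: IH; rewrite addSn.
rewrite halphabar// -!addrA ltr_pwDl ?(hqbar _ (ltnW kN))// !addr_ge0//.
- by rewrite mulr_ge0 ?exprn_even_ge0// ltW ?hrbar.
- by rewrite mulr_ge0 ?exprn_even_ge0// ltW.
Qed.

Definition equilibrium : 'I_n -> strategy R := fun i k xm =>
  - gain b r alpha k i * a k * (xm.1 - xm.2)
  - gainbar b rbar alphabar k i * a k * xm.2.

Section Deviation.
Context (i : 'I_n) (v : strategy R).
Let p := deviation equilibrium i v.
Let S := state P a b eps x0 p.
Let C := control P a b eps x0 p i.
Let known := known eps x0.

(** The coefficient left to agent i once the other agents have applied the
    feedback gains h. *)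
Definition closed_loop (h : 'I_n -> R) (k : nat) : R :=
  a k - \sum_(j < n | j != i) h j * a k * b j k.

Lemma closed_loopE h k :
  a k - \sum_(j < n) h j * a k * b j k = closed_loop h k - b i k * (h i * a k).
Proof. by rewrite /closed_loop (bigD1 i)//=; ring. Qed.

Lemma state_next k :
  S k.+1 = next_state P (closed_loop (g k) k) (closed_loop (gbar k) k)
    (b i k) (S k) (C k) (eps k.+1).
Proof.
apply/funext => w; rewrite /S /= -/p -/S (bigD1 i)//=.
rewrite /next_state /C /control -/S /centered.
have -> : \sum_(j < n | j != i) b j k * p j k (S k w, mean P (S k)) =
  - (\sum_(j < n | j != i) g k j * a k * b j k) * (S k w - mean P (S k))
  - (\sum_(j < n | j != i) gbar k j * a k * b j k) * mean P (S k).
  rewrite mulNr !mulr_suml -!sumrN -big_split/=; apply: eq_bigr => j ji.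
  rewrite /p /deviation (negPf ji) /equilibrium /= -/(g k j) -/(gbar k j).
  by ring.
by rewrite /closed_loop; ring.
Qed.

Lemma known_control k : (k < N)%N -> is_strategy N v -> known k (S k) ->
  known k (C k).
Proof.
move=> kN mv kS; rewrite /C /control /p /deviation eqxx.
apply: (measurableT_comp (mv k kN)).
by apply: measurable_fun_pair => //; exact: measurable_cst.
Qed.

Lemma known_state k : (k <= N)%N -> is_strategy N v -> known k (S k).
Proof.
move=> + mv; elim: k => [_|k IH kN]; first exact: known_x0.
have kS := IH (ltnW kN).
have kS' := knownS kS.
have kC' := knownS (known_control kN mv kS).
rewrite state_next /next_state.
apply: measurable_funD; last first.
  by apply: measurable_funM; [exact: known_centered|exact: known_eps].
apply: measurable_funD; last exact: measurable_funM.
apply: measurable_funD; last exact: measurable_cst.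
by apply: measurable_funM => //; exact: known_centered.
Qed.

(** The least cost-to-go of agent i from time k on against the equilibrium
    feedback of the others, evaluated at the state of the deviating
    trajectory. *)
Definition value (k : nat) : R :=
  alpha i k * cov P (S k) (S k) + alphabar i k * mean P (S k) ^+ 4.

Lemma next_value k : (k < N)%N -> is_strategy N v ->
    S k \in Lfun P 2%:E -> C k \in Lfun P 2%:E ->
  let A := closed_loop (g k) k in let Abar := closed_loop (gbar k) k in
  S k.+1 \in Lfun P 2%:E /\
  value k.+1 = alpha i k.+1 * (A ^+ 2 * cov P (S k) (S k)
      + 2 * A * b i k * cov P (S k) (C k) + b i k ^+ 2 * cov P (C k) (C k)
      + mean P (fun w => eps k.+1 w ^+ 2) * cov P (S k) (S k))
    + alphabar i k.+1 * (Abar * mean P (S k) + b i k * mean P (C k)) ^+ 4.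
Proof.
move=> kN mv S2 C2 A Abar.
have kS := known_state (ltnW kN) mv; have kC := known_control kN mv kS.
have [S'2 covS'] := next_cov heps_sq heps_mean heps_indep hx0_indep
  A Abar (b i k) kN kS kC S2 C2.
have [_ meanS'] := next_mean heps_sq heps_mean heps_indep hx0_indep
  A Abar (b i k) kN kS (Lfun2_Lfun1 S2) (Lfun2_Lfun1 C2).
by rewrite /value state_next; split; rewrite // covS' meanS'.
Qed.

(** The recursions for alpha and alphabar make the two sides differ by the sum
    of the excesses in [quadratic_step] and [quartic_step]. *)
Lemma value_step k : (k < N)%N -> is_strategy N v ->
    S k \in Lfun P 2%:E -> C k \in Lfun P 2%:E ->
  value k <= stage_cost P a b q qbar r rbar eps x0 p i k + value k.+1.
Proof.
move=> kN mv S2 C2; have [_ ->] := next_value kN mv S2 C2.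
pose A := closed_loop (g k) k; pose Abar := closed_loop (gbar k) k.
rewrite /value -/A -/Abar /stage_cost -/S -/C halpha// halphabar//.
have a0 := ltW (alpha_gt0 i kN); have abar0 := ltW (alphabar_gt0 i kN).
rewrite !closed_loopE -/A -/Abar.
have foc : r i k * (g k i * a k) =
    alpha i k.+1 * b i k * (A - b i k * (g k i * a k)).
  rewrite -closed_loopE /g mulrA gain_foc => [|j|j].
  - rewrite -mulrA mulrBl mul1r mulr_suml; congr (_ * (_ - _)).
    by apply: eq_bigr => j _; rewrite mulrAC.
  - exact: hr.
  - exact/ltW/alpha_gt0.
have focbar : rbar i k * (gbar k i * a k) ^+ 3 =
    alphabar i k.+1 * b i k * (Abar - b i k * (gbar k i * a k)) ^+ 3.
  rewrite -closed_loopE /gbar exprMn mulrA gainbar_foc => [|j|j].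
  - rewrite -mulrA -exprMn mulrBl mul1r mulr_suml; congr (_ * (_ - _) ^+ 3).
    by apply: eq_bigr => j _; rewrite mulrAC.
  - exact: hrbar.
  - exact/ltW/alphabar_gt0.
have rge : 0 <= r i k + alpha i k.+1 * b i k ^+ 2.
  by apply: addr_ge0; [exact: ltW (hr i kN)|exact: mulr_ge0 a0 (sqr_ge0 _)].
have h1 := quadratic_step rge foc (cov_square_ge0 (g k i * a k) S2 C2).
have h2 := quartic_step (mean P (S k)) (mean P (C k))
  (ltW (hrbar i kN)) abar0 focbar.
lra.
Qed.

Lemma value_le_cost : is_strategy N v ->
    cost_defined P N a b eps x0 p i ->
  ((value 0)%:E <= cost P N a b q qbar r rbar eps x0 p i)%E.
Proof.
move=> mv cd.
have [->|coo] := eqVneq (cost P N a b q qbar r rbar eps x0 p i) +oo%E.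
  exact: leey.
have L2 := cost_lty_Lfun2 (hq i) (hqbar i) (hr i) (hrbar i) cd.
have {}L2 k (kN : (k < N)%N) : S k \in Lfun P 2%:E /\ C k \in Lfun P 2%:E.
  by apply: L2 => //; rewrite ltey.
have SN : S N \in Lfun P 2%:E.
  have Npred : (N.-1 < N)%N by rewrite prednK.
  have [S2 C2] := L2 _ Npred.
  by have [+ _] := next_value Npred mv S2 C2; rewrite prednK.
have S2 k : (k <= N)%N -> S k \in Lfun P 2%:E.
  by rewrite leq_eqVlt => /predU1P[->//|/L2[]].
rewrite costE//; last by move=> k /L2[].
rewrite lee_fin -halphaN -halphabarN -/(value N) addrC.
suff telescope m : (m <= N)%N ->
    value 0 <= \sum_(0 <= k < m) stage_cost P a b q qbar r rbar eps x0 p i k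
      + value m.
  exact: telescope.
elim: m => [_|m IH mN]; first by rewrite big_geq// add0r.
apply: le_trans (IH (ltnW mN)) _; rewrite big_nat_recr//= -addrA lerD2l.
by have [] := L2 m mN; exact: value_step.
Qed.

End Deviation.

Lemma equilibrium_strategy i : is_strategy N (equilibrium i).
Proof.
move=> k _; apply: measurable_funB; apply: measurable_funM => //.
by apply: measurable_funB.
Qed.

Section Equilibrium_play.
Context (i : 'I_n).
Let S := state P a b eps x0 equilibrium.
Let C := control P a b eps x0 equilibrium i.

Lemma deviation_id : deviation equilibrium i (equilibrium i) = equilibrium.
Proof. by apply/funext => j; rewrite /deviation; case: eqP => [->|]. Qed.

Lemma equilibrium_control k : C k = fun w =>
  - (g k i * a k) * centered P (S k) w + - (gbar k i * a k) * mean P (S k).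
Proof.
by apply/funext => w; rewrite /C /control /equilibrium -/S /= !mulNr.
Qed.

Lemma equilibrium_Lfun1 k : (k <= N)%N -> S k \in Lfun P 1%E.
Proof.
elim: k => [_|k IH kN]; first exact: hx0.
have kS := known_state i (ltnW kN) (equilibrium_strategy i).
have := state_next i (equilibrium i) k.
rewrite deviation_id -/S -/C in kS * => ->.
have S1 := IH (ltnW kN).
have [C1 _] : has_mean P (C k) (- (g k i * a k) * 0
    + - (gbar k i * a k) * mean P (S k)).
  rewrite equilibrium_control; apply: has_meanD; last exact: has_mean_cst.
  by apply: has_meanZ; exact: has_mean_centered.
exact: (next_mean heps_sq heps_mean heps_indep hx0_indep _ _ _ kN kS S1 C1).1.
Qed.

Lemma equilibrium_cost_defined : cost_defined P N a b eps x0 equilibrium i.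
Proof.
split=> k kN; apply/Lfun1_integrable; first exact: equilibrium_Lfun1.
rewrite -/C equilibrium_control.
have h := has_meanD (has_meanZ (- (g k i * a k))
   (has_mean_centered (equilibrium_Lfun1 (ltnW kN))))
   (has_mean_cst P (- (gbar k i * a k) * mean P (S k))).
exact: h.1.
Qed.

(** The candidate is affine in the state, U = - G (X - E[X]) - Gbar E[X], so the
    moments of the control are explicit and the value recursion is an
    identity. *)
Lemma equilibrium_value_step k : (k < N)%N -> S k \in Lfun P 2%:E ->
  [/\ C k \in Lfun P 2%:E, S k.+1 \in Lfun P 2%:E &
    value i (equilibrium i) k
      = stage_cost P a b q qbar r rbar eps x0 equilibrium i k
        + value i (equilibrium i) k.+1].
Proof.
move=> kN S2.
have [C2 meanC covSC covC] := affine_cov (- (g k i * a k))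
  (- (gbar k i * a k) * mean P (S k)) S2.
rewrite -equilibrium_control in C2 meanC covSC covC.
have [] := @next_value i (equilibrium i) k kN (equilibrium_strategy i).
- by rewrite deviation_id.
- by rewrite deviation_id.
rewrite /value deviation_id -/S -/C => S'2 ->; split => //.
rewrite covSC covC meanC /stage_cost -/S -/C covC meanC halpha// halphabar//.
by rewrite !(closed_loopE i); ring.
Qed.

Lemma equilibrium_cost : (x0 : T -> R) \in Lfun P 2%:E ->
  cost P N a b q qbar r rbar eps x0 equilibrium i
    = (value i (equilibrium i) 0)%:E.
Proof.
move=> x02.
have S2 k : (k <= N)%N -> S k \in Lfun P 2%:E.
  elim: k => [_ //|k IH kN].
  by have [] := equilibrium_value_step kN (IH (ltnW kN)).
rewrite costE//; last first.
  by move=> k kN; have [] := equilibrium_value_step kN (S2 _ (ltnW kN)).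
congr EFin; rewrite -halphaN -halphabarN addrC.
have telescope m : (m <= N)%N -> value i (equilibrium i) 0 =
    \sum_(0 <= k < m) stage_cost P a b q qbar r rbar eps x0 equilibrium i k
    + value i (equilibrium i) m.
  elim: m => [_|m IH mN]; first by rewrite big_geq// add0r.
  rewrite (IH (ltnW mN)) big_nat_recr//= -addrA; congr (_ + _).
  by have [] := equilibrium_value_step mN (S2 _ (ltnW mN)).
by rewrite (telescope N)// /value deviation_id.
Qed.

End Equilibrium_play.

Lemma equilibrium_Nash : feedback_Nash P N a b q qbar r rbar eps x0 equilibrium.
Proof.
move=> i; split.
- exact: equilibrium_strategy.
- exact: equilibrium_cost_defined.
move=> v mv cd.
have [->|coo] := eqVneq
  (cost P N a b q qbar r rbar eps x0 (deviation equilibrium i v) i) +oo%E.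
  exact: leey.
have /(_ _ 0%N hN)[|x02 _] :=
  cost_lty_Lfun2 (hq i) (hqbar i) (hr i) (hrbar i) cd.
  by rewrite ltey.
(* The value at time 0 depends on x0 only, so it is the same along both
   trajectories. *)
rewrite (equilibrium_cost i x02); exact: value_le_cost.
Qed.

End Equilibrium.

Theorem proposition5 (R : realType) (d : measure_display)
    (T : measurableType d) (P : probability T R) (n N : nat)
    (a : nat -> R) (b q qbar r rbar : 'I_n -> nat -> R)
    (eps : nat -> {RV P >-> R}) (x0 : {RV P >-> R})
    (alpha alphabar : 'I_n -> nat -> R)
    (hn : (2 <= n)%N) (hN : (1 <= N)%N)
    (hq : forall i k, (k <= N)%N -> 0 < q i k)
    (hqbar : forall i k, (k <= N)%N -> 0 < qbar i k)
    (hr : forall i k, (k < N)%N -> 0 < r i k)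
    (hrbar : forall i k, (k < N)%N -> 0 < rbar i k)
    (heps0 : forall w, eps 0%N w = 0)
    (heps_sq : forall k, (k <= N)%N -> (eps k : T -> R) \in Lfun P 2%:E)
    (heps_mean : forall k, (k <= N)%N -> ('E_P[eps k] = 0)%E)
    (heps_indep : mutually_indep P N eps)
    (hx0 : (x0 : T -> R) \in Lfun P 1%E)
    (hx0_indep : indep_systems P (sigma_rv x0) (sigma_process N eps))
    (halphaN : forall i, alpha i N = q i N)
    (halphabarN : forall i, alphabar i N = qbar i N)
    (halphabar : forall i k, (k < N)%N ->
      alphabar i k = qbar i k
        + rbar i k * (gainbar b rbar alphabar k i * a k) ^+ 4
        + alphabar i k.+1
          * (a k - \sum_(j < n) gainbar b rbar alphabar k j * a k * b j k) ^+ 4)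
    (halpha : forall i k, (k < N)%N ->
      alpha i k = q i k
        + r i k * (gain b r alpha k i * a k) ^+ 2
        + alpha i k.+1
          * (a k - \sum_(j < n) gain b r alpha k j * a k * b j k) ^+ 2
        + alpha i k.+1 * mean P (fun w => eps k.+1 w ^+ 2)) :
  feedback_Nash P N a b q qbar r rbar eps x0
    (fun i k xm => - gain b r alpha k i * a k * (xm.1 - xm.2)
                   - gainbar b rbar alphabar k i * a k * xm.2).
Proof.
exact: (equilibrium_Nash hN hq hqbar hr hrbar heps_sq heps_mean heps_indep hx0
  hx0_indep halphaN halphabarN halphabar halpha).
Qed.
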